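(* Let $\mathcal{I}(\mathcal{D},\mathcal{P},\mathcal{A})$ be a two-sender unicast index coding problem with an eavesdropper, belonging to Case II-C, i.e. both interactions $\mathcal{D}_1\rightarrow\mathcal{D}_{\{1,2\}}$ and $\mathcal{D}_{\{1,2\}}\rightarrow\mathcal{D}_1$ exist, the interactions $\mathcal{D}_2\rightarrow\mathcal{D}_{\{1,2\}}$ and $\mathcal{D}_{\{1,2\}}\rightarrow\mathcal{D}_2$ do not both exist, and the interactions between $\mathcal{D}_1$ and $\mathcal{D}_2$ are arbitrary. Suppose the interactions $\mathcal{D}_1\rightarrow\mathcal{D}_{\{1,2\}}$ and $\mathcal{D}_{\{1,2\}}\rightarrow\mathcal{D}_1$ are fully-participated. If weakly secure linear index codes exist for the single-sender problems $\mathcal{I}(\mathcal{D}_{\mathcal{T}},\mathcal{A}_{\mathcal{T}})$ for all non-empty $\mathcal{T}\subseteq\{1,2\}$, then the optimal codelength $l^*=l^*(\mathcal{I}(\mathcal{D},\mathcal{P},\mathcal{A}))$ satisfies $$l^*\le\max\{l^*_{\{1,2\}},l^*_1\}+l^*_2 .$$ The bound is attained by the following weakly secure linear two-sender index code, where $\mathcal{C}_{\mathcal{T}}$ is an optimal weakly secure linear code for $\mathcal{I}(\mathcal{D}_{\mathcal{T}},\mathcal{A}_{\mathcal{T}})$: $\mathcal{S}_1$ transmits $\mathcal{C}_1+\mathcal{C}_{\{1,2\}}$ and $\mathcal{S}_2$ transmits $\mathcal{C}_2$.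
   Context: Fix a finite field $\mathbb{F}_q$ and messages $\mathcal{M}=\{x_1,\dots,x_m\}$, $x_i\in\mathbb{F}_q$; $x_i$ is a realization of a random variable $X_i$, and the $X_i$ are independent and uniform on $\mathbb{F}_q$. There are $m$ receivers; receiver $i$ demands $x_i$ and has side-information $\mathcal{K}_i\subseteq\mathcal{M}\setminus\{x_i\}$. The side-information digraph $\mathcal{D}$ has vertices $v_1,\dots,v_m$ and an edge $(v_i,v_j)$ iff $x_j\in\mathcal{K}_i$. For $\mathcal{B}\subseteq[m]=\{1,\dots,m\}$ put $x_{\mathcal{B}}=\{x_i:i\in\mathcal{B}\}$. Single-sender problem $\mathcal{I}(\mathcal{D},\mathcal{A})$: one sender knows all messages and transmits $\mathbf{G}\mathbf{x}$, $\mathbf{G}\in\mathbb{F}_q^{l\times m}$, $\mathbf{x}=(x_1,\dots,x_m)^T$; this is a linear index code of length $l$ if every receiver $i$ can recover $x_i$ from $\mathbf{G}\mathbf{x}$ and $\mathcal{K}_i$. An eavesdropper knows $x_{\mathcal{A}}$ and $\mathbf{G}\mathbf{x}$. The code is weakly secure if $H(X_i\mid\mathbf{G}\mathbf{X},X_{\mathcal{A}})=H(X_i)$ for every message index $i\notin\mathcal{A}$. Two-sender problem $\mathcal{I}(\mathcal{D},\mathcal{P},\mathcal{A})$: sender $\mathcal{S}_j$ knows $\mathcal{M}_j\subseteq\mathcal{M}$, $j\in\{1,2\}$, with $\mathcal{M}_1\cup\mathcal{M}_2=\mathcal{M}$. Put $\mathcal{P}_1=\mathcal{M}_1\setminus\mathcal{M}_2$,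 $\mathcal{P}_2=\mathcal{M}_2\setminus\mathcal{M}_1$, $\mathcal{P}_{\{1,2\}}=\mathcal{M}_1\cap\mathcal{M}_2$, $\mathcal{P}=(\mathcal{P}_1,\mathcal{P}_2,\mathcal{P}_{\{1,2\}})$. Singletons are written without braces: the non-empty $\mathcal{T}\subseteq\{1,2\}$ are $1,2,\{1,2\}$. A linear two-sender index code consists of linear codewords $\mathbf{c}_1,\mathbf{c}_2$ over $\mathbb{F}_q$ of lengths $l_1,l_2$, where $\mathbf{c}_j$ (sent by $\mathcal{S}_j$) is a linear function of the messages in $\mathcal{M}_j$ only, such that each receiver $i$ can recover $x_i$ from $\mathbf{c}_1,\mathbf{c}_2,\mathcal{K}_i$. Its length is $l_1+l_2$. An eavesdropper knows $x_{\mathcal{A}}$, $\mathcal{A}\subsetneq[m]$, and $\mathbf{c}_1,\mathbf{c}_2$; the code is weakly secure if $H(X_i\mid\mathbf{c}_1,\mathbf{c}_2,X_{\mathcal{A}})=H(X_i)$ for all $i\in[m]\setminus\mathcal{A}$. For non-empty $\mathcal{T}\subseteq\{1,2\}$, $\mathcal{D}_{\mathcal{T}}$ is the sub-digraph of $\mathcal{D}$ induced by $\{v_j:x_j\in\mathcal{P}_{\mathcal{T}}\}$ (the problem with messages and receivers restricted to $\mathcal{P}_{\mathcal{T}}$, side-information $\mathcal{K}_i\cap\mathcal{P}_{\mathcal{T}}$), and $\mathcal{A}_{\mathcal{T}}$ is the set of $i\in\mathcal{A}$ with $x_i\in\mathcal{P}_{\mathcal{T}}$. $l^*(\cdot)$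 denotes the minimum length over $\mathbb{F}_q$ of a weakly secure linear index code for the given problem, and $l^*_{\mathcal{T}}=l^*(\mathcal{I}(\mathcal{D}_{\mathcal{T}},\mathcal{A}_{\mathcal{T}}))$. For $\mathcal{T}\ne\mathcal{T}'$, the interaction $\mathcal{D}_{\mathcal{T}}\rightarrow\mathcal{D}_{\mathcal{T}'}$ exists if $\mathcal{D}$ has an edge from some vertex of $\mathcal{D}_{\mathcal{T}}$ to some vertex of $\mathcal{D}_{\mathcal{T}'}$; it is fully-participated if there are edges from every vertex of $\mathcal{D}_{\mathcal{T}}$ to every vertex of $\mathcal{D}_{\mathcal{T}'}$. For two codewords, $\mathbf{c}+\mathbf{c}'$ denotes symbol-wise addition after appending zeros at the end of the shorter one to match the length of the longer one. *)

(* Defs.v *)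
From HB Require Import structures.
From mathcomp Require Import all_boot all_order all_algebra.
From mathcomp Require Import all_classical all_reals all_analysis.

Set Implicit Arguments.
Unset Strict Implicit.
Unset Printing Implicit Defensive.

Import Order.TTheory GRing.Theory Num.Theory.

Local Open Scope classical_set_scope.
Local Open Scope ring_scope.

Section Entropy.
Context (R : realType) (d : measure_display) (T : measurableType d).
Context (Pr : probability T R).

Definition pmf (U : finType) (Y : T -> U) (u : U) : R :=
  fine (Pr (Y @^-1` [set u])).

(* Entropies are in nats. Terms with a zero probability vanish, since they
   have the joint probability as a factor. *)
Definition entropy (U : finType) (Y : T -> U) : R :=
  - \sum_(u : U) pmf Y u * ln (pmf Y u).

Definition cond_entropy (U V : finType) (Y : T -> U) (Z : T -> V) : R :=
  - \sum_(u : U) \sum_(v : V)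
      pmf (fun t => (Y t, Z t)) (u, v) *
      ln (pmf (fun t => (Y t, Z t)) (u, v) / pmf Z v).

Definition discrete_rv (U : Type) (Y : T -> U) : Prop :=
  forall S : set U, measurable (Y @^-1` S).

Definition mutually_independent (I : finType) (U : Type) (X : I -> T -> U) :
  Prop :=
  forall (B : {set I}) (S : I -> set U),
    Pr (\bigcap_(i in [set` B]) (X i @^-1` S i)) =
    (\prod_(i in B) Pr (X i @^-1` S i))%E.

Definition uniform_rv (U : finType) (Y : T -> U) : Prop :=
  forall u : U, Pr (Y @^-1` [set u]) = (#|U|%:R^-1)%:E.

End Entropy.

(* Messages are identified with their indices, so sets of messages are sets of
   indices. The index type [I] is an arbitrary finite type, as restricted
   problems are indexed by the subtype [{i | i \in B}]. *)
Section IndexCoding.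
Context (F : finFieldType).

Definition restrict (I : finType) (B : {set I}) (x : {ffun I -> F}) :
  {ffun {i | i \in B} -> F} := [ffun j => x (val j)].

Definition encode (I : finType) (l : nat) (G : 'M[F]_(l, #|I|))
  (x : {ffun I -> F}) : 'cV[F]_l := G *m \col_k x (enum_val k).

Definition decodable (I : finType) (U : Type) (K : I -> {set I})
  (c : {ffun I -> F} -> U) : Prop :=
  forall i : I, exists dec : U -> {ffun {j | j \in K i} -> F} -> F,
    forall x : {ffun I -> F}, dec (c x) (restrict (K i) x) = x i.

Context (R : realType) (d : measure_display) (T : measurableType d).
Context (Pr : probability T R).

Definition weakly_secure (I : finType) (U : finType) (X : I -> T -> F)
  (A : {set I}) (c : {ffun I -> F} -> U) : Prop :=
  forall i : I, i \notin A ->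
    cond_entropy Pr (X i)
      (fun t => (c [ffun j => X j t], restrict A [ffun j => X j t])) =
    entropy Pr (X i).

(* [K i] is the side information of receiver [i]; the side-information
   digraph has an edge from [i] to [j] iff [j \in K i]. *)
Record single_code (I : finType) := SingleCode {
  sc_len : nat;
  sc_mx : 'M[F]_(sc_len, #|I|) }.

Definition ws_single_code (I : finType) (X : I -> T -> F)
  (K : I -> {set I}) (A : {set I}) (C : single_code I) : Prop :=
  decodable K (encode (sc_mx C)) /\ weakly_secure X A (encode (sc_mx C)).

Record two_code (I : finType) := TwoCode {
  tc_len1 : nat;
  tc_len2 : nat;
  tc_enc1 : {ffun I -> F} -> 'cV[F]_tc_len1;
  tc_enc2 : {ffun I -> F} -> 'cV[F]_tc_len2 }.

Definition tc_len (I : finType) (C : two_code I) : nat :=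
  (tc_len1 C + tc_len2 C)%N.

Definition tc_enc (I : finType) (C : two_code I) (x : {ffun I -> F}) :
  'cV[F]_(tc_len1 C) * 'cV[F]_(tc_len2 C) := (tc_enc1 C x, tc_enc2 C x).

Definition linear_in (I : finType) (M : {set I}) (l : nat)
  (c : {ffun I -> F} -> 'cV[F]_l) : Prop :=
  exists G : 'M[F]_(l, #|{: {i | i \in M}}|),
    forall x : {ffun I -> F}, c x = encode G (restrict M x).

Definition ws_two_code (I : finType) (X : I -> T -> F) (K : I -> {set I})
  (M1 M2 A : {set I}) (C : two_code I) : Prop :=
  [/\ linear_in M1 (tc_enc1 C), linear_in M2 (tc_enc2 C),
      decodable K (tc_enc C) & weakly_secure X A (tc_enc C)].

End IndexCoding.

(* Minimal length of a valid code; the value is 0 if there is no valid code. *)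
Definition min_len (C : Type) (len : C -> nat) (valid : C -> Prop) : nat :=
  xget 0%N [set l | (exists2 c, valid c & len c = l) /\
                    forall c, valid c -> (l <= len c)%N].

Lemma min_lenP (C : Type) (len : C -> nat) (valid : C -> Prop) :
  (exists c, valid c) ->
  (exists2 c, valid c & len c = min_len len valid) /\
  (forall c, valid c -> (min_len len valid <= len c)%N).
Proof.
move=> [c0 vc0]; rewrite /min_len; case: xgetP => [l -> //|noL].
have ex_l : exists l, `[< exists2 c, valid c & len c = l >].
  by exists (len c0); apply/asboolP; exists c0.
case: (ex_minnP ex_l) => l /asboolP vl min_l.
case: (noL l); split=> // c vc.
by apply: min_l; apply/asboolP; exists c.
Qed.

Section OptimalLength.
Context (F : finFieldType) (R : realType) (d : measure_display).
Context (T : measurableType d) (Pr : probability T R).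

Definition lstar_single (I : finType) (X : I -> T -> F) (K : I -> {set I})
  (A : {set I}) : nat :=
  min_len (@sc_len F I) (ws_single_code Pr X K A).

Definition lstar_two (I : finType) (X : I -> T -> F) (K : I -> {set I})
  (M1 M2 A : {set I}) : nat :=
  min_len (@tc_len F I) (ws_two_code Pr X K M1 M2 A).

Definition optimal_single_code (I : finType) (X : I -> T -> F)
  (K : I -> {set I}) (A : {set I}) (C : single_code F I) : Prop :=
  ws_single_code Pr X K A C /\ sc_len C = lstar_single X K A.

End OptimalLength.

Definition sub_rv (I : finType) (T U : Type) (B : {set I}) (X : I -> T -> U) :
  {i | i \in B} -> T -> U := fun j => X (val j).

Definition sub_side (I : finType) (B : {set I}) (K : I -> {set I}) :
  {i | i \in B} -> {set {i | i \in B}} :=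
  fun j => [set k | val k \in K (val j)]%SET.

Definition sub_set (I : finType) (B A : {set I}) : {set {i | i \in B}} :=
  [set k | val k \in A]%SET.

Definition interaction (I : finType) (K : I -> {set I}) (B B' : {set I}) :
  Prop := exists i j, [/\ i \in B, j \in B' & j \in K i].

Definition fully_participated (I : finType) (K : I -> {set I})
  (B B' : {set I}) : Prop :=
  forall i j, i \in B -> j \in B' -> j \in K i.

Definition pad (F : finFieldType) (n l : nat) (c : 'cV[F]_l) : 'cV[F]_n :=
  \col_(k < n) (if insub (val k) is Some k' then c k' 0 else 0).

Definition pad_add (F : finFieldType) (l l' : nat) (c : 'cV[F]_l)
  (c' : 'cV[F]_l') : 'cV[F]_(maxn l l') := pad _ c + pad _ c'.

Definition sum_code (F : finFieldType) (I : finType) (P1 P2 P12 : {set I})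
  (C1 : single_code F {i | i \in P1}) (C2 : single_code F {i | i \in P2})
  (C12 : single_code F {i | i \in P12}) : two_code F I :=
  TwoCode
    (fun x => pad_add (encode (sc_mx C1) (restrict P1 x))
                      (encode (sc_mx C12) (restrict P12 x)))
    (fun x => encode (sc_mx C2) (restrict P2 x)).

(* Main.v *)
(* A receiver of the first or the shared part knows all messages of the other
   of these two parts by full participation, hence can cancel the foreign
   summand of the sum codeword. For security, a linear code with uniform
   messages hides message [i] from the eavesdropper iff some message vector is
   sent to the zero codeword, vanishes on [A] and has entry 1 at [i]: without
   such a vector [x_i] is determined by what the eavesdropper sees, and has
   conditional entropy 0. Extending by zero such a vector of the code of one
   part gives such a vector of the two-sender code. *)
Require Import Defs.
From HB Require Import structures.
From mathcomp Require Import all_boot all_order all_algebra.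
From mathcomp Require Import all_classical all_reals all_analysis.

Set Implicit Arguments.
Unset Strict Implicit.
Unset Printing Implicit Defensive.

Import Order.TTheory GRing.Theory Num.Theory.

Local Open Scope classical_set_scope.
Local Open Scope ring_scope.

(** * Entropies of finite-valued variables and of a uniform message vector *)

Section DiscreteEntropy.
Context (R : realType) (d : measure_display) (T : measurableType d).
Context (Pr : probability T R).

Lemma pmf_uniform (U : finType) (Y : T -> U) (u : U) :
  uniform_rv Pr Y -> Defs.pmf Pr Y u = #|U|%:R^-1.
Proof. by move=> unifY; rewrite /Defs.pmf unifY. Qed.

Lemma entropy_uniform (U : finType) (Y : T -> U) :
  (0 < #|U|)%N -> uniform_rv Pr Y -> entropy Pr Y = ln (#|U|%:R : R).
Proof.
move=> U0 unifY; rewrite /entropy (eq_bigr (fun=> #|U|%:R^-1 * - ln #|U|%:R)).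
  rewrite sumr_const mulrN mulNrn opprK -[LHS]mulr_natl mulrA divff ?mul1r //.
  by rewrite pnatr_eq0 -lt0n.
by move=> u _; rewrite (pmf_uniform _ unifY) lnV // posrE ltr0n.
Qed.

(** Each joint event is either empty or a whole fibre of [Z], so every term has a zero factor or the
    logarithm of 1. *)
Lemma cond_entropy_eq0 (U V : finType) (Y : T -> U) (Z : T -> V) :
  (forall t t', Z t = Z t' -> Y t = Y t') -> cond_entropy Pr Y Z = 0.
Proof.
move=> YZ; rewrite /cond_entropy big1 ?oppr0 // => u _; rewrite big1 // => v _.
have [[t [Yt Zt]]|noE] := pselect (exists t, Y t = u /\ Z t = v).
  have -> : Defs.pmf Pr (fun t => (Y t, Z t)) (u, v) = Defs.pmf Pr Z v.
    rewrite /Defs.pmf; congr (fine (Pr _)).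
    apply/seteqP; split => s /=; first by case.
    by move=> Zs; rewrite -Yt (YZ t s) ?Zt // Zs.
  have [->|p0] := eqVneq (Defs.pmf Pr Z v) 0; first by rewrite mul0r.
  by rewrite divff // ln1 mulr0.
rewrite [X in X * _]/Defs.pmf (_ : _ @^-1` _ = set0) ?measure0 ?mul0r //.
by apply/seteqP; split => s //= [Ys Zs]; apply: noE; exists s.
Qed.

Lemma pmf_comp (W U : finType) (V : T -> W) (g : W -> U) (u : U) :
  discrete_rv V ->
  Defs.pmf Pr (fun t => g (V t)) u = \sum_(w | g w == u) Defs.pmf Pr V w.
Proof.
move=> mV; rewrite /Defs.pmf sum_fine; last first.
  by move=> w _; exact: fin_num_measure.
congr fine; rewrite bigfs ?index_enum_uniq //; last first.
  by move=> w _; rewrite mem_index_enum.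
rewrite -measure_fin_bigcup //.
- congr (Pr _); apply/seteqP; split => t /=.
    by move=> gt; exists (V t) => //; exact/eqP.
  by move=> [w /eqP <- /= ->].
- by move=> w w' _ _ [t [/= -> ->]].
Qed.

Context (F : finFieldType) (I : finType) (X : I -> T -> F).
Hypothesis X_rv : forall i, discrete_rv (X i).
Hypothesis X_indep : mutually_independent Pr X.
Hypothesis X_unif : forall i, uniform_rv Pr (X i).

Let W t := [ffun j => X j t].

Let preimW w :
  W @^-1` [set w] = \bigcap_(i in [set` [set: I]%SET]) X i @^-1` [set w i].
Proof.
apply/seteqP; split => t /=; first by move=> <- i _ /=; rewrite ffunE.
by move=> Xw; apply/ffunP => i; rewrite ffunE; apply: Xw => /=; rewrite inE.
Qed.

Lemma discrete_rv_ffun : discrete_rv W.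
Proof.
move=> S; have -> : W @^-1` S = \bigcup_(w in S) W @^-1` [set w].
  by apply/seteqP; split => t /=; [exists (W t) | case=> w Sw /= ->].
apply: fin_bigcup_measurable; first exact: finite_finset.
move=> w _; rewrite preimW; apply: fin_bigcap_measurable => [|i _].
  exact: finite_finset.
exact: X_rv.
Qed.

(** That the value does not depend on [w] makes translations of message vectors preserve
    probabilities. *)
Lemma pmf_ffun w : Defs.pmf Pr W w = #|F|%:R^-1 ^+ #|I|.
Proof.
rewrite /Defs.pmf preimW X_indep.
rewrite (eq_bigr (fun=> (#|F|%:R^-1)%:E)); last by move=> i _; exact: X_unif.
by rewrite prodEFin /= prodr_const cardsT.
Qed.

(* Translation by multiples of [z] permutes the fibres of [g] and makes the
   [i]-th message equidistributed on each of them. *)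
Lemma cond_entropy_invariant (U : finType) (g : {ffun I -> F} -> U) i
    (z : {ffun I -> F}) :
  z i = 1 -> (forall a x, g (x + [ffun j => a * z j]) = g x) ->
  cond_entropy Pr (X i) (fun t => g (W t)) = entropy Pr (X i).
Proof.
move=> zi gz; pose p u v := Defs.pmf Pr (fun t => (X i t, g (W t))) (u, v).
have pE u v :
    p u v = \sum_(w : {ffun I -> F} | (w i, g w) == (u, v)) Defs.pmf Pr W w.
  rewrite -(pmf_comp (fun w : {ffun I -> F} => (w i, g w))); last first.
    exact: discrete_rv_ffun.
  rewrite /p; congr (Defs.pmf Pr _ _).
  by apply/funext => t; rewrite [W t i]ffunE.
(* Translation by [(u - u') * z] takes the vectors with entry [u'] at [i] to those with entry [u]
   and keeps the value of [g]. *)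
have p_const u u' v : p u v = p u' v.
  rewrite !pE (reindex_inj (addIr [ffun j => (u - u') * z j])) /=.
  apply: eq_big => [w|w _]; last by rewrite !pmf_ffun.
  rewrite gz !xpair_eqE !ffunE zi mulr1; congr (_ && _).
  by rewrite addrCA addrC -subr_eq0 addrK subr_eq0.
have sum_u v : Defs.pmf Pr (fun t => g (W t)) v = \sum_u p u v.
  rewrite pmf_comp; last exact: discrete_rv_ffun.
  rewrite (partition_big (fun w : {ffun I -> F} => w i) xpredT) //=.
  apply: eq_bigr => u _; rewrite pE; apply: eq_bigl => w.
  by rewrite xpair_eqE andbC.
have sum_v u : #|F|%:R^-1 = \sum_v p u v.
  rewrite -(pmf_uniform u (X_unif i)).
  have -> : X i = (fun t => W t i) by apply/funext => t; rewrite ffunE.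
  rewrite (pmf_comp (fun w : {ffun I -> F} => w i)); last first.
    exact: discrete_rv_ffun.
  rewrite (partition_big g xpredT) //=.
  by apply: eq_bigr => v _; rewrite pE; apply: eq_bigl => w.
(* The weight of [u] is split over all [v]. By [p_const] the fibre over [v] has mass [#|F|] times
   [p u v], so the ratio in the logarithm is [#|F|^-1]; terms with [p u v = 0] are set aside before
   dividing. *)
rewrite /cond_entropy /entropy; congr (- _); apply: eq_bigr => u _.
rewrite (pmf_uniform u (X_unif i)) [X in _ = X * _](sum_v u) big_distrl /=.
apply: eq_bigr => v _; rewrite -/(p u v).
have [->|p0] := eqVneq (p u v) 0; first by rewrite !mul0r.
congr (_ * ln _); rewrite sum_u (eq_bigr (fun=> p u v)) => [|u' _]; last first.
  exact: p_const.
by rewrite sumr_const -[X in _ / X]mulr_natl invfM mulrCA divff // mulr1.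
Qed.

End DiscreteEntropy.

(** * Linear encoders, zero padding and decodability *)

Section LinearCodes.
Context (F : finFieldType).

Lemma encodeD (I : finType) l (G : 'M[F]_(l, #|I|)) x y :
  encode G (x + y) = encode G x + encode G y.
Proof.
rewrite /encode -mulmxDr; congr (_ *m _).
by apply/colP => k; rewrite !mxE ffunE.
Qed.

Lemma encodeZ (I : finType) l (G : 'M[F]_(l, #|I|)) a (x : {ffun I -> F}) :
  encode G [ffun j => a * x j] = a *: encode G x.
Proof.
rewrite /encode scalemxAr; congr (_ *m _).
by apply/colP => k; rewrite !mxE ffunE.
Qed.

Lemma restrictD (I : finType) (B : {set I}) (x y : {ffun I -> F}) :
  Defs.restrict B (x + y) = Defs.restrict B x + Defs.restrict B y.
Proof. by apply/ffunP => j; rewrite !ffunE. Qed.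

Lemma restrictZ (I : finType) (B : {set I}) a (x : {ffun I -> F}) :
  Defs.restrict B [ffun j => a * x j] = [ffun j => a * Defs.restrict B x j].
Proof. by apply/ffunP => j; rewrite !ffunE. Qed.

Lemma eq_restrict (I : finType) (B : {set I}) (x y : {ffun I -> F}) :
  Defs.restrict B x = Defs.restrict B y <-> {in B, x =1 y}.
Proof.
split=> [/ffunP xy j jB|xy]; first by have := xy (Sub j jB); rewrite !ffunE.
by apply/ffunP => j; rewrite !ffunE xy // (valP j).
Qed.

Lemma linear_in_encode (I : finType) (B M : {set I}) l
    (G : 'M[F]_(l, #|{: {i | i \in B}}|)) :
  B \subset M -> linear_in M (fun x => encode G (Defs.restrict B x)).
Proof.
move=> /fintype.subsetP sBM.
(* The 0/1 factor selects the messages of [B] among those of [M], matching the two enumerations. *)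
exists (G *m \matrix_(k, k') (val (enum_val k) == val (enum_val k'))%:R) => x.
rewrite /encode -mulmxA; congr (_ *m _); apply/colP => k; rewrite !mxE ffunE.
pose j : {i | i \in M} := Sub (val (enum_val k)) (sBM _ (valP (enum_val k))).
rewrite (bigD1 (enum_rank j)) //= big1 ?addr0 => [|k' k'j].
  by rewrite !mxE ffunE enum_rankK /= eqxx mul1r.
rewrite !mxE; case: eqP => [eqk|_]; last by rewrite mul0r.
case/eqP: k'j; apply: enum_val_inj; rewrite enum_rankK; apply: val_inj.
exact: esym.
Qed.

(** As a matrix product, padding inherits linearity from matrix algebra. *)
Lemma padE n l (c : 'cV[F]_l) : pad n c = pid_mx l *m c.
Proof.
apply/colP => k; rewrite !mxE; case: insubP => [k' _ kk'|].
  rewrite (bigD1 k') //= big1 ?addr0 => [|j jk'].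
    by rewrite !mxE -kk' eqxx ltn_ord mul1r.
  rewrite !mxE -kk' (inj_eq val_inj) eq_sym (negPf jk').
  by rewrite mul0r.
rewrite -leqNgt => lk; rewrite big1 // => j _; rewrite mxE ltnNge lk andbF.
by rewrite mul0r.
Qed.

(** For [n < l], [pad] would truncate; under the bound every entry survives. *)
Lemma pad_inj n l : (l <= n)%N -> injective (@pad F n l).
Proof.
move=> ln c c' /colP cc'; apply/colP => k; have := cc' (widen_ord ln k).
by rewrite !mxE /= insubT // => ?; congr (c _ _ = c' _ _); apply: val_inj.
Qed.

Lemma linear_in_pad_add (I : finType) (M : {set I}) l l'
    (c : {ffun I -> F} -> 'cV[F]_l) (c' : {ffun I -> F} -> 'cV[F]_l') :
  linear_in M c -> linear_in M c' ->
  linear_in M (fun x => pad_add (c x) (c' x)).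
Proof.
move=> [G cG] [G' cG']; exists (pid_mx l *m G + pid_mx l' *m G') => x.
by rewrite /pad_add !padE cG cG' /encode !mulmxA mulmxDl.
Qed.

Lemma pad_addD l l' (c d : 'cV[F]_l) (c' d' : 'cV[F]_l') :
  pad_add (c + d) (c' + d') = pad_add c c' + pad_add d d'.
Proof. by rewrite /pad_add !padE !mulmxDr addrACA. Qed.

Lemma pad_addZ l l' a (c : 'cV[F]_l) (c' : 'cV[F]_l') :
  pad_add (a *: c) (a *: c') = a *: pad_add c c'.
Proof. by rewrite /pad_add !padE -!scalemxAr scalerDr. Qed.

(** Trades decoding functions for a condition on pairs of message vectors, in which summands can be
    cancelled. *)
Lemma decodableP (I : finType) (U : Type) (K : I -> {set I})
    (c : {ffun I -> F} -> U) :
  decodable K c <->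
  (forall i x y, c x = c y -> {in K i, x =1 y} -> x i = y i).
Proof.
split=> [dec i x y cxy /eq_restrict Kxy|dec i].
  by have [D DE] := dec i; rewrite -(DE x) -(DE y) cxy Kxy.
(* The decoder picks any vector consistent with what is received. The default 0 is never reached, as
   the true vector is consistent. *)
exists (fun u k =>
  xget 0 [set x | c x = u /\ Defs.restrict (K i) x = k] i) => x.
by case: xgetP => [y -> /= [cy /eq_restrict Ky]|/(_ x) []//]; exact: dec.
Qed.

End LinearCodes.

(** Two realizations that look alike to the eavesdropper but differ at [i] have a difference that
    can be scaled to the required vector. If there are none, the conditional entropy is 0, against
    [ln #|F| > 0]. *)
Lemma weakly_secure_kernel (F : finFieldType) (R : realType)
    (d : measure_display) (T : measurableType d) (Pr : probability T R)
    (I : finType) (X : I -> T -> F) (A : {set I}) l (G : 'M[F]_(l, #|I|)) i :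
  uniform_rv Pr (X i) -> weakly_secure Pr X A (encode G) -> i \notin A ->
  exists z : {ffun I -> F},
    [/\ encode G z = 0, {in A, forall j, z j = 0} & z i = 1].
Proof.
move=> unifX secG iA; apply: contrapT => noz.
have F0 : (0 < #|F|)%N by apply/card_gt0P; exists 0.
suff H0 : entropy Pr (X i) = 0.
  have : (0 : R) < ln #|F|%:R by rewrite ln_gt0 // ltr1n card_finNzRing_gt1.
  by rewrite -(entropy_uniform F0 unifX) H0 ltxx.
rewrite -(secG i iA); apply: cond_entropy_eq0 => t t' [cE /eq_restrict AE].
apply: contrapT => /eqP Xi; apply: noz.
set w := [ffun j => X j t] in cE AE; set w' := [ffun j => X j t'] in cE AE.
(* The difference is written with the factor -1 so that [encodeD] and [encodeZ] apply. *)
pose y := w + [ffun j => -1 * w' j].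
have yi : y i != 0 by rewrite !ffunE mulN1r subr_eq0.
exists [ffun j => (y i)^-1 * y j]; split.
- by rewrite encodeZ encodeD encodeZ cE scaleN1r subrr scaler0.
- by move=> j jA; rewrite ffunE [y j]ffunE [X in _ + X]ffunE AE // mulN1r subrr
    mulr0.
- by rewrite ffunE mulVf.
Qed.

(** * Linearity, decodability and security of the sum code *)

Section SumCode.
Context (F : finFieldType) (I : finType) (M1 M2 : {set I}).
Hypothesis M_cover : (M1 :|: M2 = [set: I])%SET.
Let P1 := (M1 :\: M2)%SET.
Let P2 := (M2 :\: M1)%SET.
Let P12 := (M1 :&: M2)%SET.
Context (C1 : single_code F {i | i \in P1}) (C2 : single_code F {i | i \in P2}).
Context (C12 : single_code F {i | i \in P12}).
Let C := sum_code C1 C2 C12.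

Lemma in_parts i : [\/ i \in P1, i \in P2 | i \in P12].
Proof.
have : i \in (M1 :|: M2)%SET by rewrite M_cover inE.
rewrite !inE; case: (i \in M1); case: (i \in M2) => //= _.
- exact: Or33.
- exact: Or31.
- exact: Or32.
Qed.

Lemma tc_encD x y : tc_enc C (x + y) = tc_enc C x + tc_enc C y.
Proof. by rewrite /tc_enc /= !restrictD !encodeD pad_addD. Qed.

Lemma tc_encZ a (x : {ffun I -> F}) :
  tc_enc C [ffun j => a * x j] = (a *: (tc_enc C x).1, a *: (tc_enc C x).2).
Proof. by rewrite /tc_enc /= !restrictZ !encodeZ pad_addZ. Qed.

Lemma sum_code_linear1 : linear_in M1 (tc_enc1 C).
Proof.
apply: linear_in_pad_add; apply: linear_in_encode.
  exact: finset.subsetDl.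
exact: finset.subsetIl.
Qed.

Lemma sum_code_linear2 : linear_in M2 (tc_enc2 C).
Proof. exact/linear_in_encode/finset.subsetDl. Qed.

(** A receiver in [B] holds at least the side information that the restricted problem grants it. *)
Lemma decode_restrict (K : I -> {set I}) (B : {set I})
    (CB : single_code F {i | i \in B}) i x y :
  decodable (sub_side K) (encode (sc_mx CB)) -> i \in B ->
  encode (sc_mx CB) (Defs.restrict B x) =
    encode (sc_mx CB) (Defs.restrict B y) ->
  {in K i, x =1 y} -> x i = y i.
Proof.
move=> /decodableP dec iB cE KE.
have := dec (Sub i iB) _ _ cE; rewrite !ffunE /=; apply=> j.
by rewrite inE /= => /KE; rewrite !ffunE.
Qed.

Lemma sum_code_decodable (K : I -> {set I}) :
  fully_participated K P1 P12 -> fully_participated K P12 P1 ->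
  decodable (sub_side K) (encode (sc_mx C1)) ->
  decodable (sub_side K) (encode (sc_mx C2)) ->
  decodable (sub_side K) (encode (sc_mx C12)) ->
  decodable K (tc_enc C).
Proof.
move=> full1 full12 dec1 dec2 dec12; apply/decodableP => i x y [cE cE2] KE.
have [iP|iP|iP] := in_parts i; last first.
- have E1 : Defs.restrict P1 x = Defs.restrict P1 y.
    by apply/eq_restrict => j jP; exact/KE/full12.
  apply: (decode_restrict dec12 iP) KE.
  (* The known summand cancels, and padding up to the maximal length loses nothing of the other. *)
  by move: cE; rewrite /pad_add E1 => /addrI; exact/pad_inj/leq_maxr.
- exact: (decode_restrict dec2 iP cE2).
- have E12 : Defs.restrict P12 x = Defs.restrict P12 y.
    by apply/eq_restrict => j jP; exact/KE/full1.
  apply: (decode_restrict dec1 iP) KE.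
  by move: cE; rewrite /pad_add E12 => /addIr; exact/pad_inj/leq_maxl.
Qed.

Context (R : realType) (d : measure_display) (T : measurableType d).
Context (Pr : probability T R) (X : I -> T -> F).
Hypothesis X_rv : forall i, discrete_rv (X i).
Hypothesis X_indep : mutually_independent Pr X.
Hypothesis X_unif : forall i, uniform_rv Pr (X i).

(** Extension by zero: entries outside [B] vanish, so vanishing on the part of [A] inside [B] gives
    vanishing on [A]. The zeros outside [B] also silence the codes of the other parts. *)
Lemma kernel_extension (A B : {set I}) (CB : single_code F {i | i \in B}) i :
  weakly_secure Pr (sub_rv (B := B) X) (sub_set B A) (encode (sc_mx CB)) ->
  i \in B -> i \notin A ->
  exists z : {ffun I -> F}, [/\ encode (sc_mx CB) (Defs.restrict B z) = 0,
    {in A, forall j, z j = 0}, (forall j, j \notin B -> z j = 0) & z i = 1].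
Proof.
move=> secB iB iA.
have [||z [cz Az zi]] := weakly_secure_kernel (i := Sub i iB) _ secB.
- exact: X_unif.
- by rewrite inE.
exists [ffun j => if insub j is Some k then z k else 0]; split.
- rewrite -[RHS]cz; congr encode; apply/ffunP => j.
  rewrite !ffunE; case: insubP => [k _ kj|]; last by case/negP; exact: valP.
  by congr (z _); apply: val_inj.
- move=> j jA; rewrite ffunE; case: insubP => // k _ kj.
  by apply: Az; rewrite inE kj.
- by move=> j jB; rewrite ffunE insubN.
- by rewrite ffunE insubT.
Qed.

Lemma sum_code_secure (A : {set I}) :
  weakly_secure Pr (sub_rv (B := P1) X) (sub_set P1 A) (encode (sc_mx C1)) ->
  weakly_secure Pr (sub_rv (B := P2) X) (sub_set P2 A) (encode (sc_mx C2)) ->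
  weakly_secure Pr (sub_rv (B := P12) X) (sub_set P12 A) (encode (sc_mx C12)) ->
  weakly_secure Pr X A (tc_enc C).
Proof.
move=> sec1 sec2 sec12 i iA.
have enc0 (B B' : {set I}) (CB : single_code F {i | i \in B'})
    (z : {ffun I -> F}) :
    [disjoint B & B']%bool -> (forall j, j \notin B -> z j = 0) ->
    encode (sc_mx CB) (Defs.restrict B' z) = 0.
  move=> BB' zB; rewrite /encode (_ : \col_k _ = 0) ?mulmx0 //.
  apply/colP => k; rewrite !mxE ffunE zB // (disjointFl BB') //.
  exact: (valP (enum_val k)).
have padd0 l l' : pad_add (0 : 'cV[F]_l) (0 : 'cV[F]_l') = 0.
  by rewrite /pad_add !padE !mulmx0 addr0.
have D1_2 : [disjoint P1 & P2]%bool.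
  by rewrite -finset.setI_eq0; apply/eqP/finset.setP => j; rewrite !inE;
    do !case: (_ \in _).
have D1_12 : [disjoint P1 & P12]%bool.
  by rewrite -finset.setI_eq0; apply/eqP/finset.setP => j; rewrite !inE;
    do !case: (_ \in _).
have D2_12 : [disjoint P2 & P12]%bool.
  by rewrite -finset.setI_eq0; apply/eqP/finset.setP => j; rewrite !inE;
    do !case: (_ \in _).
have [z [cz Az zi]] : exists z : {ffun I -> F},
    [/\ tc_enc C z = 0, {in A, forall j, z j = 0} & z i = 1].
  rewrite /tc_enc /=; have [iP|iP|iP] := in_parts i.
  - have [z [cz Az zB zi]] := kernel_extension sec1 iP iA.
    exists z; split=> //.
    by rewrite cz !(enc0 P1) // padd0.
  - have [z [cz Az zB zi]] := kernel_extension sec2 iP iA.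
    exists z; split=> //.
    by rewrite cz !(enc0 P2) ?(disjoint_sym (mem P2) (mem P1)) // padd0.
  - have [z [cz Az zB zi]] := kernel_extension sec12 iP iA.
    exists z; split=> //.
    by rewrite cz !(enc0 P12) 1?disjoint_sym // padd0.
(* Adding multiples of [z] changes neither the codewords nor the messages in [A], which together
   form the eavesdropper's view. *)
apply: (cond_entropy_invariant X_rv X_indep X_unif
  (g := fun x => (tc_enc C x, Defs.restrict A x)) zi) => a x.
congr (_, _).
  by rewrite tc_encD tc_encZ cz /= !scaler0 addr0.
by apply/eq_restrict => j jA; rewrite !ffunE Az // mulr0 addr0.
Qed.

End SumCode.

(** * The length bound and the code attaining it *)

Theorem corollary2
  (F : finFieldType) (R : realType) (d : measure_display)
  (T : measurableType d) (Pr : probability T R)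
  (m : nat) (X : 'I_m -> T -> F)
  (X_rv : forall i, discrete_rv (X i))
  (X_indep : mutually_independent Pr X)
  (X_unif : forall i, uniform_rv Pr (X i))
  (K : 'I_m -> {set 'I_m}) (K_irr : forall i, i \notin K i)
  (M1 M2 : {set 'I_m}) (M_cover : (M1 :|: M2 = [set: 'I_m])%SET)
  (A : {set 'I_m}) (A_proper : A \proper [set: 'I_m]%SET) :
  let P1 := (M1 :\: M2)%SET in
  let P2 := (M2 :\: M1)%SET in
  let P12 := (M1 :&: M2)%SET in
  let exists_code (B : {set 'I_m}) :=
    exists C, ws_single_code Pr (sub_rv (B := B) X) (sub_side K) (sub_set B A) C in
  let optimal (B : {set 'I_m}) :=
    optimal_single_code Pr (sub_rv (B := B) X) (sub_side K) (sub_set B A) in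
  let lstar (B : {set 'I_m}) :=
    lstar_single Pr (sub_rv (B := B) X) (sub_side K) (sub_set B A) in
  interaction K P1 P12 ->
  interaction K P12 P1 ->
  ~ (interaction K P2 P12 /\ interaction K P12 P2) ->
  fully_participated K P1 P12 ->
  fully_participated K P12 P1 ->
  exists_code P1 -> exists_code P2 -> exists_code P12 ->
  (lstar_two Pr X K M1 M2 A <= maxn (lstar P12) (lstar P1) + lstar P2)%N /\
  forall C1 C2 C12, optimal P1 C1 -> optimal P2 C2 -> optimal P12 C12 ->
    ws_two_code Pr X K M1 M2 A (sum_code C1 C2 C12) /\
    tc_len (sum_code C1 C2 C12) = (maxn (lstar P12) (lstar P1) + lstar P2)%N.
Proof.
move=> P1 P2 P12 ex opt lstar _ _ _ full1 full12 ex1 ex2 ex12.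
have valid C1 C2 C12 : opt P1 C1 -> opt P2 C2 -> opt P12 C12 ->
    ws_two_code Pr X K M1 M2 A (sum_code C1 C2 C12) /\
    tc_len (sum_code C1 C2 C12) = (maxn (lstar P12) (lstar P1) + lstar P2)%N.
  move=> [[dec1 sec1] len1] [[dec2 sec2] len2] [[dec12 sec12] len12].
  split; last by rewrite /tc_len /= len1 len2 len12 maxnC.
  split.
  - exact: sum_code_linear1.
  - exact: sum_code_linear2.
  - exact: sum_code_decodable.
  - exact: sum_code_secure.
split=> [|//].
(* Minimal lengths are attained as soon as some valid code exists. *)
have optP B : ex B -> exists C, opt B C.
  by move=> /(min_lenP (@sc_len F _))[[C vC lC] _]; exists C.
have [C1 o1] := optP _ ex1.
have [C2 o2] := optP _ ex2.
have [C12 o12] := optP _ ex12.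
(* The right-hand side becomes the length of a valid two-sender code, which minimality bounds from
   below. *)
have [vC <-] := valid _ _ _ o1 o2 o12.
by have [_] := min_lenP (@tc_len F _) (ex_intro _ _ vC); apply.
Qed.
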